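(* For $n\ge 1$, the number of $\pi\in S_n$ avoiding both arrow patterns $(12;3\to 1)$ and $(1;1\to 1)$ equals the $n$-th Riordan number $r_n$.
   Context: Standard cycle form of $\sigma\in S_n$: product of disjoint cycles (fixed points included), each cycle starting with its largest element, cycles listed in increasing order of largest elements. The fundamental bijection $\theta:S_n\to S_n$ erases the parentheses of the standard cycle form to give a one-line permutation. For $\pi\in S_n$, $\hat\pi=\theta^{-1}(\pi)$. An arrow pattern $(\nu;H)$ of size $k$: a string $\nu=a_1\dots a_m$ of positive integers and a set $H$ of arrows $b\to c$, with all integers appearing forming $[k]$. $\pi\in S_n$ contains $(\nu;H)$ if there is $X=\{x_1<\dots<x_k\}\subseteq[n]$ with positions $t_1<\dots<t_m$ such that $\pi_{t_1}\cdots\pi_{t_m}=x_{a_1}\cdots x_{a_m}$ and $\hat\pi(x_b)=x_c$ for every arrow $b\to c\in H$; otherwise it avoids it. In particular $\pi$ avoids $(1;1\to1)$ iff $\hat\pi$ has no fixed points. The Riordan number $r_n$ (OEIS A005043: $1,0,1,1,3,6,15,\dots$) is the number of noncrossing set partitions of $[n]$ with no singleton blocks; its generating function is $\frac{1+x-\sqrt{1-2x-3x^2}}{2x(1+x)}$. *)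

(* Defs.v *)
From mathcomp Require Import all_boot all_fingroup.

Set Implicit Arguments.
Unset Strict Implicit.
Unset Printing Implicit Defensive.

(* [n] is represented by 'I_n = {0, .., n-1}, so every letter is shifted down  *)
(* by one; only the relative order of letters matters.  A permutation p : 'S_n *)
(* has one-line notation p 0, p 1, .., p (n-1).                                *)

Section FundamentalBijection.
Variable n : nat.
Implicit Types s p : 'S_n.

Definition cycle_max s (m : 'I_n) := [forall x in porbit s m, x <= m].

Definition cycle_word s (m : 'I_n) : seq 'I_n := traject s m #|porbit s m|.

(* The cycles in order: enum 'I_n lists the cycle maxima increasingly. *)
Definition standard_cycle_form s : seq (seq 'I_n) :=
  [seq cycle_word s m | m <- enum 'I_n & cycle_max s m].

Definition theta_word s : seq 'I_n := flatten (standard_cycle_form s).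

Lemma cycle_max_ex s x : exists2 m, cycle_max s m & m \in porbit s x.
Proof.
case: (@arg_maxnP _ x [in porbit s x] (@nat_of_ord n) (porbit_id s x)).
move=> m mx ge_m.
exists m => //; apply/forall_inP => y.
have -> : porbit s m = porbit s x by apply/eqP; rewrite eq_porbit_mem.
exact: ge_m.
Qed.

Lemma cycle_max_uniq s m1 m2 :
  cycle_max s m1 -> cycle_max s m2 -> m1 \in porbit s m2 -> m1 = m2.
Proof.
move=> /forall_inP h1 /forall_inP h2 h; apply/val_inj/anti_leq.
by rewrite h2 //= h1 // porbit_sym.
Qed.

Lemma mem_cycle_word s m x : (x \in cycle_word s m) = (x \in porbit s m).
Proof. by rewrite porbit_traject. Qed.

Lemma theta_word_perm s : perm_eq (theta_word s) (enum 'I_n).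
Proof.
apply/allP=> x _ /=; rewrite [X in _ == X]count_uniq_mem ?enum_uniq // mem_enum.
have [m mmax mx] := cycle_max_ex s x.
rewrite count_flatten -map_comp sumnE big_map big_filter.
rewrite (eq_bigr (fun i => (i == m) : nat)); last first.
  move=> i imax; rewrite /= count_uniq_mem ?uniq_traject_porbit //.
  rewrite mem_cycle_word porbit_sym; congr (nat_of_bool _).
  apply/idP/eqP => [ix | -> //].
  apply: (cycle_max_uniq imax mmax).
  move: ix mx; rewrite -!eq_porbit_mem => /eqP <- /eqP ->; exact: eqxx.
rewrite big_enum_cond /= (bigD1 m) //= eqxx big1 // => i /andP[_ /negPf -> //].
Qed.

Lemma size_theta_word s : size (theta_word s) == n.
Proof. by rewrite (perm_size (theta_word_perm s)) size_enum_ord. Qed.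

Lemma tnth_theta_word_inj s : injective (tnth (Tuple (size_theta_word s))).
Proof.
apply/tuple_uniqP; rewrite /= (perm_uniq (theta_word_perm s)); exact: enum_uniq.
Qed.

Definition theta s : 'S_n := perm (@tnth_theta_word_inj s).

Definition std_block (b : seq 'I_n) :=
  if b is m :: t then all (fun x : 'I_n => x < m) t else false.

Definition block_lt (b c : seq 'I_n) :=
  if (b, c) is (m :: _, m' :: _) then m < m' else false.

Lemma flatten_std_inj bs bs' :
  all std_block bs -> sorted block_lt bs ->
  all std_block bs' -> sorted block_lt bs' ->
  flatten bs = flatten bs' -> bs = bs'.
Proof.
have aux (m : 'I_n) (t t' : seq 'I_n) r r' :
    all std_block r -> path block_lt (m :: t) r ->
    all (fun x : 'I_n => x < m) t' ->
    t ++ flatten r = t' ++ flatten r' -> size t' <= size t.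
  move=> ar pr at' e; rewrite leqNgt; apply/negP => lt_t.
  have := congr1 (fun u => nth m u (size t)) e.
  rewrite !nth_cat ltnn subnn lt_t => hd.
  have := all_nthP m at' _ lt_t; rewrite -hd {e hd}.
  case: r ar pr => [|[|m' u] r] //=; first by rewrite ltnn.
  by move=> _ /andP[/ltnW lmm' _]; rewrite ltnNge lmm'.
elim: bs bs' => [|b bs IH] [|b' bs'] //=.
- by case: b' => //= m t _ _ /andP[].
- by case: b => //= m t /andP[].
case: b b' => [|m t] [|m' t'] //=.
move=> /andP[at_ abs] pbs /andP[at' abs'] pbs' [em e]; subst m'.
have st : size t = size t'.
  apply/anti_leq; rewrite (aux _ _ _ _ _ abs' pbs' at_ (esym e)).
  by rewrite (aux _ _ _ _ _ abs pbs at' e).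
move/eqP: e; rewrite eqseq_cat // => /andP[/eqP -> /eqP e].
by rewrite (IH _ abs (path_sorted pbs) abs' (path_sorted pbs') e).
Qed.

Lemma cycle_wordE s m : cycle_word s m = m :: behead (cycle_word s m).
Proof.
rewrite /cycle_word; have : 0 < #|porbit s m|.
  by apply/card_gt0P; exists m; exact: porbit_id.
by case: #|_|.
Qed.

Lemma standard_cycle_form_std s : all std_block (standard_cycle_form s).
Proof.
apply/allP => b /mapP[m]; rewrite mem_filter => /andP[/forall_inP mm _] ->.
have := uniq_traject_porbit s m; rewrite -/(cycle_word s m).
have mw x : x \in cycle_word s m -> x <= m by rewrite mem_cycle_word; exact: mm.
move: mw; rewrite cycle_wordE; set t := behead _ => mw /= /andP[mt _].
apply/allP => x xt; rewrite ltn_neqAle mw ?inE ?xt ?orbT // andbT.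
by apply: contraNneq mt => /val_inj <-.
Qed.

Lemma standard_cycle_form_sorted s : sorted block_lt (standard_cycle_form s).
Proof.
rewrite /standard_cycle_form sorted_map.
have e : relpre (cycle_word s) block_lt =2 (fun i j : 'I_n => i < j).
  by move=> i j; rewrite /= (cycle_wordE s i) (cycle_wordE s j).
rewrite (eq_sorted e).
apply: sorted_filter; first by move=> ? ? ?; exact: ltn_trans.
by have := iota_ltn_sorted 0 n; rewrite -val_enum_ord sorted_map.
Qed.

Lemma cycle_word_next s m x : x \in cycle_word s m ->
  s x = next (cycle_word s m) x.
Proof.
move=> xm; have cyc : fcycle s (cycle_word s m).
  rewrite /cycle_word; have : iter #|porbit s m| s m = m by exact: iter_porbit.
  have : 0 < #|porbit s m| by apply/card_gt0P; exists m; exact: porbit_id.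
  case: #|_| => // k _ /= e; rewrite rcons_path fpath_traject /=.
  by rewrite last_traject e.
exact/eqP/(next_cycle cyc xm).
Qed.

Lemma theta_inj : injective theta.
Proof.
move=> s s' e; have ew : theta_word s = theta_word s'.
  suff: Tuple (size_theta_word s) = Tuple (size_theta_word s') by case.
  by apply: eq_from_tnth => i; have := congr1 (fun p : 'S_n => p i) e; rewrite !permE.
have ec : standard_cycle_form s = standard_cycle_form s'.
  by apply: flatten_std_inj ew; rewrite ?standard_cycle_form_std ?standard_cycle_form_sorted.
apply/permP => x.
have : x \in theta_word s by rewrite (perm_mem (theta_word_perm s)) mem_enum.
case/flattenP => b bs xb; have bs' := bs; rewrite ec in bs'.
case/mapP: bs => m _ eb; case/mapP: bs' => m' _ eb'.
by rewrite (@cycle_word_next s m) -?eb // (@cycle_word_next s' m') -?eb'.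
Qed.

(* The inverse of theta, evaluated at p. *)
Definition hat p : 'S_n := invF theta_inj p.

End FundamentalBijection.

Section ArrowPatterns.

(* Every letter of [k] appears in the string or in an arrow. *)
Definition covers (m k : nat) (w : m.-tuple 'I_k) (H : {set 'I_k * 'I_k}) :=
  forall i : 'I_k,
    i \in w \/ exists2 h : 'I_k * 'I_k, h \in H & i = h.1 \/ i = h.2.

(* An arrow pattern of size k whose string has length m; an arrow b -> c is    *)
(* the pair (b, c).                                                            *)
Record arrow_pattern (m k : nat) := ArrowPattern {
  pat_word : m.-tuple 'I_k;
  pat_arrows : {set 'I_k * 'I_k};
  pat_covers : covers pat_word pat_arrows
}.

Definition increasing (k n : nat) (x : {ffun 'I_k -> 'I_n}) :=
  [forall i : 'I_k, forall j : 'I_k, (i < j) ==> (x i < x j)].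

(* The chosen values x_1 < .. < x_k are given by x, and their positions        *)
(* t_1 < .. < t_m by t.                                                        *)
Definition contains (m k n : nat) (P : arrow_pattern m k) (p : 'S_n) : bool :=
  [exists x : {ffun 'I_k -> 'I_n}, exists t : {ffun 'I_m -> 'I_n},
    [&& increasing x, increasing t,
        [forall j, p (t j) == x (tnth (pat_word P) j)] &
        [forall h in pat_arrows P, hat p (x h.1) == x h.2]]].

Definition avoids (m k n : nat) (P : arrow_pattern m k) (p : 'S_n) : bool :=
  ~~ contains P p.

Lemma letter_proof k a : 0 < a <= k -> a.-1 < k.
Proof. by case: a. Qed.

(* The letter a of [k] = {1, .., k}, shifted to 'I_k.                          *)
Definition letter (k a : nat) (a_in : 0 < a <= k) : 'I_k :=
  Ordinal (letter_proof a_in).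

Local Notation L k a := (@letter k a isT).

Lemma covers_12_3to1 : covers [tuple L 3 1; L 3 2] [set (L 3 3, L 3 1)].
Proof.
case=> [[|[|[|]]]] // h.
- by left; rewrite inE; apply/orP; left; apply/eqP/val_inj.
- by left; rewrite !inE; apply/orP; right; apply/eqP/val_inj.
- by right; exists (L 3 3, L 3 1); [rewrite inE | left; exact/val_inj].
Qed.

Definition pattern_12_3to1 : arrow_pattern 2 3 := ArrowPattern covers_12_3to1.

Lemma covers_1_1to1 : covers [tuple L 1 1] [set (L 1 1, L 1 1)].
Proof. by move=> i; left; rewrite (ord1 i) inE; apply/eqP/val_inj. Qed.

Definition pattern_1_1to1 : arrow_pattern 1 1 := ArrowPattern covers_1_1to1.

End ArrowPatterns.

Section Riordan.

Definition noncrossing (n : nat) (P : {set {set 'I_n}}) : bool :=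
  [forall A in P, forall B in P, forall a : 'I_n in A, forall c : 'I_n in A,
     forall b : 'I_n in B, forall d : 'I_n in B,
      [&& a < b, b < c & c < d] ==> (A == B)].

Definition riordan (n : nat) : nat :=
  #|[set P : {set {set 'I_n}} |
      [&& partition P [set: 'I_n], noncrossing P & [forall B in P, #|B| != 1]]]|.

End Riordan.

(* Main.v *)
Require Import Defs.
From mathcomp Require Import all_boot all_fingroup.

(* Write w for the word of theta s.  A descent c a of w (c > a) is the same as
   an arrow c -> a of s, because each cycle starts with its maximum and the
   maxima increase.  Avoiding (12; 3->1) therefore means avoiding the vincular
   pattern 31-2, which amounts to avoiding 312.  As each cycle word starts with
   its maximum, this forces every cycle word to be decreasing; hence s is
   determined by its set of cycles, and a 312 with letters in different cycles
   is exactly a crossing of these cycles.  So s |-> porbits s is a bijection onto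
   the noncrossing partitions, and fixed points correspond to singletons. *)

Set Implicit Arguments.
Unset Strict Implicit.
Unset Printing Implicit Defensive.

Lemma gtn_ord_trans n : transitive (fun x y : 'I_n => y < x).
Proof. by move=> y x z /[swap]; exact: ltn_trans. Qed.

(** * Order of letters in the standard cycle word *)

Section StandardOrder.
Variable n : nat.
Implicit Types (s p : 'S_n) (m x y a b c : 'I_n).

Definition before s x y := index x (theta_word s) < index y (theta_word s).

(** Avoidance of (12; 3->1) read on [s = hat p]: the arrow is [s c = a], and the positions of the
    letters 1 and 2 are compared in the word of [s]. *)
Definition descent_avoiding s :=
  forall a b c, a < b -> b < c -> s c = a -> ~~ before s a b.

Lemma theta_word_uniq s : uniq (theta_word s).
Proof. by rewrite (perm_uniq (theta_word_perm s)) enum_uniq. Qed.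

Lemma hatK p : theta (hat p) = p.
Proof. exact: f_invF. Qed.

Lemma thetaK s : hat (theta s) = s.
Proof. exact: invF_f. Qed.

(** Since [theta (hat p) = p], the word of [hat p] is the one-line notation of [p], so a letter sits
    at its preimage under [p]. *)
Lemma before_hat p x y : before (hat p) x y = (p^-1%g x < p^-1%g y).
Proof.
have e i : index (p i) (theta_word (hat p)) = i.
  rewrite -{1}[p]hatK permE (tnth_nth (p i)) index_uniq ?theta_word_uniq //.
  by rewrite (eqP (size_theta_word _)).
by rewrite /before -{1}[x](permKV p) -{1}[y](permKV p) !e.
Qed.

Lemma cycle_max_le s m x : cycle_max s m -> x \in cycle_word s m -> x <= m.
Proof. by move=> /forall_inP h; rewrite mem_cycle_word; exact: h. Qed.

Lemma theta_word_split s m : cycle_max s m -> exists u v,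
  theta_word s = u ++ cycle_word s m ++ v /\
  forall m' y, cycle_max s m' -> m < m' -> y \in cycle_word s m' -> y \in v.
Proof.
move=> mm; set r := [seq m <- enum 'I_n | cycle_max s m].
have mr : m \in r by rewrite mem_filter mm mem_enum.
(* The maxima are listed increasingly, so a larger maximum cannot lie in the part [r1] preceding
   [m]. *)
have : sorted (fun i j : 'I_n => i < j) r.
  apply: sorted_filter; first by move=> ? ? ?; exact: ltn_trans.
  by have := iota_ltn_sorted 0 n; rewrite -val_enum_ord sorted_map.
rewrite /theta_word /standard_cycle_form -/r.
have : forall m', cycle_max s m' -> m' \in r.
  by move=> m' mm'; rewrite mem_filter mm' mem_enum.
case/splitPr: mr => r1 r2 inr.
rewrite sorted_pairwise; last by move=> ? ? ?; exact: ltn_trans.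
rewrite pairwise_cat => /and3P[/allrelP lt1 _ _].
exists (flatten (map (cycle_word s) r1)), (flatten (map (cycle_word s) r2)).
split; first by rewrite map_cat flatten_cat.
move=> m' y mm' lt ym'; apply/flattenP; exists (cycle_word s m') => //.
apply: map_f; have := inr _ mm'; rewrite mem_cat inE => /or3P[r1m||//].
  by have := lt1 m' m r1m (mem_head _ _); rewrite ltnNge (ltnW lt).
by move/eqP=> e; rewrite e ltnn in lt.
Qed.

Lemma before_cycles s m m' x y : cycle_max s m -> cycle_max s m' -> m < m' ->
  x \in cycle_word s m -> y \in cycle_word s m' -> before s x y.
Proof.
move=> mm mm' lt xm ym'; have [u [v [e h]]] := theta_word_split mm.
have yv := h _ _ mm' lt ym'; have := theta_word_uniq s; rewrite /before e.
rewrite !cat_uniq has_cat negb_or => /and4P[_ /andP[nu nv] _ /andP[nw _]].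
have xu : x \notin u := hasPn nu _ xm.
have yu : y \notin u := hasPn nv _ yv.
have yw : y \notin cycle_word s m := hasPn nw _ yv.
rewrite !index_cat (negPf xu) (negPf yu) xm (negPf yw) ltn_add2l.
by apply: ltn_addr; rewrite index_mem.
Qed.

Lemma before_cycle s m x y : cycle_max s m ->
  x \in cycle_word s m -> y \in cycle_word s m ->
  before s x y = (index x (cycle_word s m) < index y (cycle_word s m)).
Proof.
move=> mm xm ym; have [u [v [e _]]] := theta_word_split mm.
have := theta_word_uniq s; rewrite /before e.
rewrite !cat_uniq has_cat negb_or => /and4P[_ /andP[nu nv] _ _].
have xu : x \notin u := hasPn nu _ xm.
have yu : y \notin u := hasPn nu _ ym.
by rewrite !index_cat (negPf xu) (negPf yu) xm ym ltn_add2l.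
Qed.

(** * Cycle words as trajectories, and their monotonicity *)

Lemma iter_cycle_word s m i : i < #|porbit s m| ->
  iter i s m \in cycle_word s m.
Proof.
move=> lt; rewrite /cycle_word -(nth_traject s lt) mem_nth //.
by rewrite size_traject.
Qed.

Lemma index_iter s m i : i < #|porbit s m| ->
  index (iter i s m) (cycle_word s m) = i.
Proof.
move=> lt; rewrite /cycle_word -(nth_traject s lt) index_uniq //.
  by rewrite size_traject.
exact: uniq_traject_porbit.
Qed.

Lemma cycle_wordP s m x : x \in cycle_word s m ->
  exists2 i, i < #|porbit s m| & x = iter i s m.
Proof. by move/trajectP=> [i lt ->]; exists i. Qed.

(* A trajectory cannot jump below a value b that occurs later in the word: the
   step doing so would be an arrow forming the pattern with b. *)
Lemma iter_stays_above s m b j k : descent_avoiding s -> j <= k ->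
    b < iter j s m -> (forall l, j < l <= k -> before s (iter l s m) b) ->
  b < iter k s m.
Proof.
move=> av; elim: k => [|k IH]; first by rewrite leqn0 => /eqP->.
rewrite leq_eqVlt => /predU1P[<- //|]; rewrite ltnS => jk bj bef.
have bk : b < iter k s m.
  by apply: IH => // l /andP[jl lk]; rewrite bef // jl ltnW.
have := bef k.+1; rewrite ltnS jk leqnn => /(_ isT) bab.
rewrite ltnNge leq_eqVlt; apply/norP; split.
  by apply/eqP=> /val_inj e; move: bab; rewrite e /before ltnn.
by apply/negP=> ab; move: bab; apply/negP; exact: av ab bk _.
Qed.

Lemma cycle_word_decreasing s m : descent_avoiding s -> cycle_max s m ->
  sorted (fun x y => y < x) (cycle_word s m).
Proof.
move=> av mm; rewrite sorted_pairwise; last exact: gtn_ord_trans.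
apply/(pairwiseP m) => j k; rewrite !inE size_traject => jn kn jk.
rewrite !nth_traject //; set b := iter k s m.
have bw : b \in cycle_word s m by exact: iter_cycle_word.
(* The trajectory starts at the maximum [m], which exceeds [b], and its letters up to index [j < k]
   all precede [b]; so it is still above [b] at index [j]. *)
apply: (iter_stays_above (j := 0)) => // [|l /andP[_ lj]].
  rewrite /= ltn_neqAle (cycle_max_le mm bw) andbT; apply/eqP=> /val_inj e.
  have := index_iter kn; rewrite -/b e cycle_wordE /= eqxx => e0.
  by rewrite -e0 in jk.
have ln := leq_ltn_trans lj jn.
rewrite (before_cycle mm) ?iter_cycle_word // !index_iter //.
exact: leq_ltn_trans lj jk.
Qed.

(** * The orbits as a noncrossing partition *)

Lemma mem_porbits s x : porbit s x \in porbits s.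
Proof. exact: imset_f. Qed.

Lemma partition_porbits s : partition (porbits s) [set: 'I_n].
Proof.
apply/and3P; split.
- apply/eqP/setP=> x; rewrite inE; apply/bigcupP.
  by exists (porbit s x); rewrite ?mem_porbits ?porbit_id.
- apply/trivIsetP=> _ _ /imsetP[x _ ->] /imsetP[y _ ->]; apply: contraR.
  case/pred0Pn=> z /andP[/=]; rewrite -!eq_porbit_mem.
  by move=> /eqP <-.
- by apply/imsetP=> -[x _ e]; have := porbit_id s x; rewrite -e inE.
Qed.

(** The cycle of [m] lies entirely before [b] in the word. Being decreasing, it visits [c] before
    [a], so it would fall from above [b] to below [b], against [iter_stays_above]. *)
Lemma noncrossing_lt s m m' a b c : descent_avoiding s ->
    cycle_max s m -> cycle_max s m' -> m < m' ->
    a \in cycle_word s m -> c \in cycle_word s m -> b \in cycle_word s m' ->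
  a < b -> b < c -> False.
Proof.
move=> av mm mm' lt am cm bm ab bc.
have [k kn ea] := cycle_wordP am; have [j jn ec] := cycle_wordP cm.
suff jk : j <= k.
  have : b < iter k s m; last by rewrite -ea ltnNge (ltnW ab).
  apply: (iter_stays_above av jk); rewrite -?ec // => l /andP[_ lk].
  by apply: before_cycles lt _ bm => //; apply/iter_cycle_word/(leq_ltn_trans lk).
rewrite leqNgt; apply/negP=> kj.
have : c < a; last by rewrite ltnNge (ltnW (ltn_trans ab bc)).
have := cycle_word_decreasing av mm; move/(sorted_ltn_nth _ m)=> h.
have := h (@gtn_ord_trans n) k j; rewrite !inE size_traject => /(_ kn jn kj).
by rewrite !nth_traject // -ea -ec.
Qed.

Lemma noncrossing_porbits s : descent_avoiding s -> noncrossing (porbits s).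
Proof.
move=> av; apply/forall_inP=> A /imsetP[x _ eA]; apply/forall_inP=> B /imsetP[y _ eB].
have [m mm mA] := cycle_max_ex s x; have [m' mm' mB] := cycle_max_ex s y.
have {}eA : A = porbit s m by rewrite eA; apply/esym/eqP; rewrite eq_porbit_mem.
have {}eB : B = porbit s m' by rewrite eB; apply/esym/eqP; rewrite eq_porbit_mem.
apply/forall_inP=> a aA; apply/forall_inP=> c cA.
apply/forall_inP=> b bB; apply/forall_inP=> d dB.
apply/implyP=> /and3P[ab bc cd].
move: aA cA bB dB; rewrite eA eB -!mem_cycle_word => aA cA bB dB.
(* Of the crossing [a < b < c < d], three consecutive letters suffice: [a, b, c] if the cycle of [a]
   and [c] comes first, [b, c, d] otherwise. *)
case: (ltngtP m m') => [lt|lt|/val_inj -> //].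
  by case: (noncrossing_lt av mm mm' lt aA cA bB ab bc).
by case: (noncrossing_lt av mm' mm lt bB dB cA bc cd).
Qed.

(** A decreasing cycle word is determined by its set of letters, and [s] is the cyclic successor in
    its cycle words. *)
Lemma porbits_descent_avoiding_inj s s' :
  descent_avoiding s -> descent_avoiding s' -> porbits s = porbits s' -> s = s'.
Proof.
move=> av av' e.
have eo x : porbit s x = porbit s' x.
  have tI : trivIset (porbits s) by case/and3P: (partition_porbits s).
  have h : porbit s x \in porbits s by exact: mem_porbits.
  have h' : porbit s' x \in porbits s by rewrite e mem_porbits.
  by rewrite -(def_pblock tI h (porbit_id s x)) (def_pblock tI h' (porbit_id s' x)).
apply/permP=> x; have [m mm mx] := cycle_max_ex s x.
have mm' : cycle_max s' m by rewrite /cycle_max -eo.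
have ew : cycle_word s m = cycle_word s' m.
  apply: (@irr_sorted_eq _ (fun x y : 'I_n => y < x)).
  - exact: gtn_ord_trans.
  - by move=> ?; exact: ltnn.
  - exact: cycle_word_decreasing.
  - exact: cycle_word_decreasing.
  - by move=> y; rewrite !mem_cycle_word eo.
have xw : x \in cycle_word s m by rewrite mem_cycle_word porbit_sym.
by rewrite (cycle_word_next xw) ew -cycle_word_next // -ew.
Qed.

Lemma mem_porbit_fconnect s x y : (y \in porbit s x) = fconnect s x y.
Proof.
apply/porbitP/idP => [[i ->]|/iter_findex <-]; first by rewrite permX fconnect_iter.
by exists (findex s x y); rewrite permX.
Qed.

(** If [a] precedes [b], the cycle of [a] comes no later than that of [b]. A common cycle would be
    decreasing and put [b] first; distinct cycles would cross. *)
Lemma noncrossing_descent_avoiding s :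
    noncrossing (porbits s) ->
    (forall m, cycle_max s m -> sorted (fun x y => y < x) (cycle_word s m)) ->
  descent_avoiding s.
Proof.
move=> nc dec a b c ab bc sca; apply/negP=> bef.
have [m mm ma] := cycle_max_ex s a; have [m' mm' mb] := cycle_max_ex s b.
have cm : c \in cycle_word s m.
  rewrite mem_cycle_word porbit_sym; have := porbit_perm s 1 c.
  by rewrite expg1 sca => <-.
have am : a \in cycle_word s m by rewrite mem_cycle_word porbit_sym.
have bm : b \in cycle_word s m' by rewrite mem_cycle_word porbit_sym.
case: (ltngtP m m') => [lt|lt|/val_inj e].
(* The maximum [m'] is the fourth letter of the crossing: [a < b < c <= m < m']. *)
- have cle : c <= m := cycle_max_le mm cm.
  move: nc => /forall_inP/(_ _ (mem_porbits s m)).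
  move=> /forall_inP/(_ _ (mem_porbits s m')).
  rewrite !mem_cycle_word in am bm cm.
  move=> /forall_inP/(_ _ am)/forall_inP/(_ _ cm)/forall_inP/(_ _ bm).
  move=> /forall_inP/(_ _ (porbit_id s m')).
  rewrite ab bc (leq_ltn_trans cle lt) /=.
  rewrite eq_porbit_mem => /(cycle_max_uniq mm mm') e.
  by rewrite e ltnn in lt.
- have := before_cycles mm' mm lt bm am.
  by rewrite /before ltnNge (ltnW bef).
- rewrite -e in bm; move: bef; rewrite (before_cycle mm am bm) => lt.
  by have := sorted_ltn_index (@gtn_ord_trans n) (dec m mm) _ _ am bm lt; rewrite ltnNge (ltnW ab).
Qed.

(** * The permutation built from a partition *)

Definition decreasing_word (B : {set 'I_n}) : seq 'I_n := rev (enum B).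

Lemma mem_decreasing_word B x : (x \in decreasing_word B) = (x \in B).
Proof. by rewrite mem_rev mem_enum. Qed.

Lemma decreasing_word_uniq B : uniq (decreasing_word B).
Proof. by rewrite rev_uniq enum_uniq. Qed.

Lemma decreasing_word_sorted B : sorted (fun x y => y < x) (decreasing_word B).
Proof.
rewrite rev_sorted /enum_mem; apply: sorted_filter.
  by move=> ? ? ?; exact: ltn_trans.
by have := iota_ltn_sorted 0 n; rewrite -val_enum_ord sorted_map enumT.
Qed.

Section PartitionPermutation.
Variable P : {set {set 'I_n}}.
Hypothesis partP : partition P [set: 'I_n].

Let triv : trivIset P. Proof. by case/and3P: partP. Qed.

Let mem_block x : x \in pblock P x.
Proof. by rewrite mem_pblock (cover_partition partP). Qed.

(** [next] is cyclic: the smallest element of a block goes to the largest, so each block becomes one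
    cycle. *)
Definition next_in_block x := next (decreasing_word (pblock P x)) x.

Lemma pblock_next x : pblock P (next_in_block x) = pblock P x.
Proof.
apply: same_pblock triv _.
by rewrite -mem_decreasing_word mem_next mem_decreasing_word mem_block.
Qed.

Lemma next_in_block_inj : injective next_in_block.
Proof.
move=> x y e; have eb : pblock P x = pblock P y by rewrite -pblock_next e pblock_next.
by apply: (can_inj (prev_next (decreasing_word_uniq (pblock P y)))); rewrite -{1}eb; exact: e.
Qed.

Definition block_perm : 'S_n := perm next_in_block_inj.

Lemma block_perm_cycle B : B \in P -> fcycle block_perm (decreasing_word B).
Proof.
move=> BP; rewrite (@eq_in_cycle _ [in B] _ (frel (next (decreasing_word B)))).
- exact/cycle_next/decreasing_word_uniq.
- move=> x y xB yB; rewrite /= permE /next_in_block (def_pblock triv BP) //.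
- by apply/allP=> x; rewrite mem_decreasing_word.
Qed.

Lemma porbit_block_perm x : porbit block_perm x = pblock P x.
Proof.
have xP : pblock P x \in P by rewrite pblock_mem // (cover_partition partP).
apply/setP=> y; rewrite mem_porbit_fconnect.
by rewrite (fconnect_cycle (block_perm_cycle xP)) mem_decreasing_word.
Qed.

Lemma porbits_block_perm : porbits block_perm = P.
Proof.
apply/setP=> B; apply/imsetP/idP=> [[x _ ->]|BP].
  by rewrite porbit_block_perm pblock_mem // (cover_partition partP).
have /set0Pn[x xB] : B != set0.
  by apply: contraTneq BP => ->; case/and3P: partP.
by exists x => //; rewrite porbit_block_perm (def_pblock triv BP).
Qed.

(** Both words are trajectories of [block_perm] of the same length, so it is enough that they start
    at the same letter. *)
Lemma cycle_word_block_perm m : cycle_max block_perm m ->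
  cycle_word block_perm m = decreasing_word (pblock P m).
Proof.
move=> mm; have := mem_block m; rewrite -mem_decreasing_word => md.
have := decreasing_word_sorted (pblock P m).
have : fcycle block_perm (decreasing_word (pblock P m)).
  by apply: block_perm_cycle; rewrite pblock_mem // (cover_partition partP).
have : size (decreasing_word (pblock P m)) = #|porbit block_perm m|.
  by rewrite size_rev -cardE porbit_block_perm.
have : {subset decreasing_word (pblock P m) <= cycle_word block_perm m}.
  by move=> x; rewrite mem_decreasing_word mem_cycle_word porbit_block_perm.
rewrite /cycle_word; case: decreasing_word md => // x q md sub <- /= cyc.
rewrite path_sortedE; last exact: gtn_ord_trans.
move=> /andP[/allP lt _]; move: cyc; rewrite rcons_path => /andP[pq _].
(* If [m] occurred after the head [x] of the decreasing word, it would be smaller than [x], although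
   it is the maximum of its cycle. *)
suff -> : m = x by rewrite -fpathE.
move: md; rewrite inE => /predU1P[//|/lt mx].
have := cycle_max_le mm (sub x (mem_head _ _)).
by rewrite leqNgt mx.
Qed.

Lemma block_perm_descent_avoiding :
  noncrossing P -> descent_avoiding block_perm.
Proof.
move=> nc; apply: noncrossing_descent_avoiding.
  by rewrite porbits_block_perm.
by move=> m mm; rewrite cycle_word_block_perm // decreasing_word_sorted.
Qed.

End PartitionPermutation.

(** * Translation of the two arrow patterns *)

Lemma avoids_12_3to1P p :
  reflect (descent_avoiding (hat p)) (avoids pattern_12_3to1 p).
Proof.
apply: (iffP idP) => [av a b c ab bc hc|av].
  apply: contra av; rewrite before_hat => bef.
  (* The chosen values are [a < b < c]; the positions are those of [a] and [b] in [p], increasing by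
     [bef]. *)
  apply/existsP; exists [ffun i : 'I_3 => nth a [:: a; b; c] i].
  apply/existsP; exists [ffun i : 'I_2 => nth a [:: p^-1%g a; p^-1%g b] i].
  apply/and4P; split.
  - apply/forallP=> -[[|[|[|//]]] i3]; apply/forallP=> -[[|[|[|//]]] j3];
      rewrite !ffunE //=; exact: ltn_trans ab bc.
  - by apply/forallP=> -[[|[|//]] i3]; apply/forallP=> -[[|[|//]] j3]; rewrite !ffunE.
  - by apply/forallP=> -[[|[|//]] i3]; rewrite !ffunE (tnth_nth (letter (k:=3) (a:=1) isT)) /= permKV.
  - by apply/forall_inP=> h; rewrite inE => /eqP ->; rewrite !ffunE /= hc.
apply/negP=> /existsP[x /existsP[t /and4P[/forallP xinc /forallP tinc /forallP pt /forallP hx]]].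
have x01 := forallP (xinc (@Ordinal 3 0 isT)) (@Ordinal 3 1 isT).
have x12 := forallP (xinc (@Ordinal 3 1 isT)) (@Ordinal 3 2 isT).
have t01 := forallP (tinc (@Ordinal 2 0 isT)) (@Ordinal 2 1 isT).
have p0 := pt (@Ordinal 2 0 isT); have p1 := pt (@Ordinal 2 1 isT).
have h := implyP (hx (letter (k:=3) (a:=3) isT, letter (k:=3) (a:=1) isT)) (set11 _).
(* Identifies the letters 1, 2, 3 with the ordinals 0, 1, 2, whose bound proofs differ. *)
have l (k a : nat) (aP : 0 < a <= k) (i : 'I_k) : val i = a.-1 -> letter aP = i.
  by move=> e; apply: val_inj.
move: p0 p1 h; rewrite !(tnth_nth (letter (k:=3) (a:=1) isT)) /=.
rewrite !(l 3 1 _ (@Ordinal 3 0 isT)) // !(l 3 2 _ (@Ordinal 3 1 isT)) //.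
rewrite !(l 3 3 _ (@Ordinal 3 2 isT)) // => /eqP p0 /eqP p1 /eqP h.
have := av _ _ _ x01 x12 h.
by rewrite before_hat -p0 -p1 !permK (implyP t01).
Qed.

(** Any value [a] occurs in [p], at position [p^-1 a], so an occurrence of the pattern amounts to a
    fixed point of [hat p]. *)
Lemma avoids_1_1to1 p : avoids pattern_1_1to1 p = [forall x, hat p x != x].
Proof.
rewrite -negb_exists; congr (~~ _); apply/existsP/existsP => [[x]|[a /eqP ha]].
  move=> /existsP[t /and4P[_ _ _ /forall_inP h]].
  by have := h _ (set11 _); exists (x (letter (k:=1) (a:=1) isT)).
exists [ffun _ => a]; apply/existsP; exists [ffun _ => p^-1%g a].
apply/and4P; split.
- by apply/forallP=> i; apply/forallP=> j; rewrite !ord1.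
- by apply/forallP=> i; apply/forallP=> j; rewrite !ord1.
- by apply/forallP=> i; rewrite !ffunE permKV.
- by apply/forall_inP=> h; rewrite !ffunE ha.
Qed.

Lemma card_porbit_eq1 s x : (#|porbit s x| == 1) = (s x == x).
Proof.
apply/idP/eqP => [/cards1P[y e]|sx].
  have := porbit_id s x; rewrite {1}e inE => /eqP ex.
  have := mem_porbit s 1 x; rewrite expg1 e inE => /eqP ->.
  by rewrite -ex.
apply/cards1P; exists x; apply/setP=> y; rewrite inE.
apply/porbitP/eqP => [[i ->]|->]; last by exists 0; rewrite perm1.
by rewrite permX; elim: i => //= i ->.
Qed.

Lemma no_singleton_porbits s :
  [forall B in porbits s, #|B| != 1] = [forall x, s x != x].
Proof.
apply/forall_inP/forallP => [h x|h _ /imsetP[x _ ->]].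
  by rewrite -card_porbit_eq1 h // mem_porbits.
by rewrite card_porbit_eq1.
Qed.

End StandardOrder.

Theorem theorem6p4 : forall n : nat, 1 <= n ->
  #|[set p : 'S_n | avoids pattern_12_3to1 p && avoids pattern_1_1to1 p]|
  = riordan n.
Proof.
(* Two goals arise: the image of the avoiding set is the set counted by [riordan], and the map is
   injective on the avoiding set. *)
move=> n _; rewrite /riordan -(card_in_imset (f := fun p => porbits (hat p))).
  apply: eq_card => P; rewrite inE; apply/imsetP/and3P.
    case=> p; rewrite inE avoids_1_1to1 => /andP[/avoids_12_3to1P av fp] ->.
    by rewrite partition_porbits noncrossing_porbits // no_singleton_porbits.
  case=> partP nc ns; exists (theta (block_perm partP)).
    rewrite inE avoids_1_1to1 thetaK -no_singleton_porbits porbits_block_perm ns.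
    by rewrite andbT; apply/avoids_12_3to1P; rewrite thetaK; exact: block_perm_descent_avoiding.
  by rewrite thetaK porbits_block_perm.
move=> p q; rewrite !inE => /andP[/avoids_12_3to1P avp _] /andP[/avoids_12_3to1P avq _] e.
by rewrite -[p]hatK -[q]hatK (porbits_descent_avoiding_inj avp avq e).
Qed.
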